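(* Let $\beta=\beta^{(3)}=\{\beta_{ij}\}_{i,j\in\mathbb{Z}_+,\,0\le i+j\le 3}$ be a real doubly indexed finite sequence with $\beta_{00}>0$, with associated matrices $\mathcal{M}(1)$ and $B(2)$. Suppose that $\mathcal{M}(1)$ is positive definite and $\operatorname{Ran}B(2)\subseteq\operatorname{Ran}\mathcal{M}(1)$. Let $W$ be a real $3\times 3$ matrix with $\mathcal{M}(1)W=B(2)$, and let $b$ be the $(1,3)$ entry and $y$ the $(2,2)$ entry of the symmetric matrix $W^{T}\mathcal{M}(1)W$. If $b\neq y$, then $\beta$ admits a $4$-atomic representing measure.
   Context: For a real sequence $\beta^{(3)}=\{\beta_{ij}\}_{0\le i+j\le 3}$ set $$\mathcal{M}(1)=\begin{pmatrix}\beta_{00}&\beta_{10}&\beta_{01}\\ \beta_{10}&\beta_{20}&\beta_{11}\\ \beta_{01}&\beta_{11}&\beta_{02}\end{pmatrix},\qquad B(2)=\begin{pmatrix}\beta_{20}&\beta_{11}&\beta_{02}\\ \beta_{30}&\beta_{21}&\beta_{12}\\ \beta_{21}&\beta_{12}&\beta_{03}\end{pmatrix}.$$ $\operatorname{Ran}$ denotes the range (column space) of a matrix. Writing $$W^{T}\mathcal{M}(1)W=\begin{pmatrix}x&a&b\\ a&y&t\\ b&t&z\end{pmatrix}$$ defines the real numbers $b$ and $y$. A representing measure for $\beta^{(3)}$ is a positive Borel measure $\mu$ on $\mathbb{R}^2$ such that $\beta_{ij}=\int x^iy^j\,d\mu$ for all $i,j\in\mathbb{Z}_+$ with $0\le i+j\le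 3$. A measure is $r$-atomic if it has the form $\mu=\sum_{k=1}^{r}\rho_k\delta_{(x_k,y_k)}$ with weights $\rho_k>0$ and $r$ distinct points (atoms) $(x_k,y_k)\in\mathbb{R}^2$. *)

(* Defs.v *)
From HB Require Import structures.
From mathcomp Require Import all_boot all_order all_algebra.
From mathcomp Require Import all_classical all_reals all_analysis.
Set Implicit Arguments.
Unset Strict Implicit.
Unset Printing Implicit Defensive.
Import Order.TTheory GRing.Theory Num.Theory.
Local Open Scope classical_set_scope.
Local Open Scope ring_scope.

(* A finite sequence {beta_ij}_{i + j <= 3} is represented by a total function
   beta : nat -> nat -> R; only its values with i + j <= 3 are ever used. *)

Definition mx3_of_rows (R : realType) (rows : seq (seq R)) : 'M[R]_3 :=
  \matrix_(i < 3, j < 3) ((nth [::] rows i)`_j).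

(* rows and columns indexed by the monomials 1, X, Y *)
Definition moment_mx1 (R : realType) (beta : nat -> nat -> R) : 'M[R]_3 :=
  mx3_of_rows [:: [:: beta 0 0; beta 1 0; beta 0 1];
                  [:: beta 1 0; beta 2 0; beta 1 1];
                  [:: beta 0 1; beta 1 1; beta 0 2]]%N.

(* rows indexed by 1, X, Y and columns by X^2, XY, Y^2 *)
Definition moment_B2 (R : realType) (beta : nat -> nat -> R) : 'M[R]_3 :=
  mx3_of_rows [:: [:: beta 2 0; beta 1 1; beta 0 2];
                  [:: beta 3 0; beta 2 1; beta 1 2];
                  [:: beta 2 1; beta 1 2; beta 0 3]]%N.

Definition posdefmx (R : realType) (n : nat) (M : 'M[R]_n) : Prop :=
  M^T = M /\ forall v : 'cV[R]_n, v != 0 -> 0 < (v^T *m M *m v) 0 0.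

Definition mx_range (R : realType) (m n : nat) (A : 'M[R]_(m, n)) :
    set 'cV[R]_m :=
  range (fun v : 'cV[R]_n => A *m v).

(* The product sigma-algebra carried by R * R is the Borel sigma-algebra of
   R^2, since R is second countable.  Integrability is stated separately
   because the integral is total: a non-integrable function also has one. *)
Definition representing_measure (R : realType) (beta : nat -> nat -> R)
    (mu : {measure set (measurableTypeR R * measurableTypeR R)%type
                   -> \bar R}) : Prop :=
  forall i j : nat, (i + j <= 3)%N ->
    mu.-integrable setT (fun p => (p.1 ^+ i * p.2 ^+ j)%:E) /\
    (\int[mu]_p (p.1 ^+ i * p.2 ^+ j)%:E = (beta i j)%:E)%E.

Definition atomic (R : realType) (r : nat)
    (mu : {measure set (measurableTypeR R * measurableTypeR R)%type
                   -> \bar R}) : Prop :=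
  exists (rho : 'I_r -> R)
         (pt : 'I_r -> measurableTypeR R * measurableTypeR R),
    [/\ forall k, 0 < rho k, injective pt &
        forall A, measurable A ->
          mu A = (\sum_(k < r) (rho k)%:E * \d_(pt k) A)%E].

(* Main.v *)
(* After an affine change of variables M(1) is a multiple of the identity, so
   only the third moments a = L(x^3), b = L(x^2 y), c = L(x y^2), d = L(y^3)
   remain.  The compressions to span(1, x, y) of the multiplications by x and y
   are symmetric 3x3 matrices which commute precisely when the b and y of the
   theorem agree.  When they disagree, one extra dimension suffices to extend
   them to commuting symmetric 4x4 matrices A and B.  The joint eigenvalues of
   A and B are the atoms, and the squared moduli of the coordinates of the
   vector 1 in a joint orthonormal eigenbasis are the weights (up to the factor
   beta_00).  Because 1 is cyclic for A and B, all four weights are positive and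
   the atoms are distinct. *)

Require Import Defs.
From HB Require Import structures.
From mathcomp Require Import all_boot all_order all_algebra.
From mathcomp Require Import all_classical all_reals all_analysis.
From mathcomp Require Import measurable_realfun complex.
From mathcomp Require Import ring lra.
Set Implicit Arguments.
Unset Strict Implicit.
Unset Printing Implicit Defensive.
Import Order.TTheory GRing.Theory Num.Theory.
Local Open Scope classical_set_scope.
Local Open Scope ring_scope.

(** * Integration against finite sums of weighted Dirac masses *)

(** [msum] sums a family indexed by [nat], so atoms are reached through [inord], which requires the
    nonempty index type ['I_n.+1]. *)
Definition weighted_diracs (d : measure_display)
    (T : measurableType d) (R : realType) (n : nat)
    (rho : 'I_n.+1 -> {nonneg R}) (pt : 'I_n.+1 -> T) : {measure set T -> \bar R} :=
  msum (fun k : nat => mscale (rho (inord k)) (\d_(pt (inord k)))) n.+1.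

Lemma weighted_diracsE (d : measure_display)
    (T : measurableType d) (R : realType) (n : nat)
    (rho : 'I_n.+1 -> {nonneg R}) (pt : 'I_n.+1 -> T) (A : set T) :
  weighted_diracs rho pt A = (\sum_(k < n.+1) (rho k)%:num%:E * \d_(pt k) A)%E.
Proof. by apply: eq_bigr => k _; rewrite /= /mscale inord_val. Qed.

Lemma ge0_integral_weighted_diracs (d : measure_display)
    (T : measurableType d) (R : realType)
    (n : nat) (rho : 'I_n.+1 -> {nonneg R}) (pt : 'I_n.+1 -> T)
    (f : T -> \bar R) (f0 : forall x, (0%R <= f x)%E)
    (mf : measurable_fun setT f) :
  (\int[weighted_diracs rho pt]_(x in setT) f x
    = \sum_(k < n.+1) (rho k)%:num%:E * f (pt k))%E.
Proof.
rewrite ge0_integral_measure_sum//; apply: eq_bigr => k _.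
by rewrite ge0_integral_mscale// integral_dirac// diracT mul1e inord_val.
Qed.

Lemma integrable_weighted_diracs (d : measure_display)
    (T : measurableType d) (R : realType)
    (n : nat) (rho : 'I_n.+1 -> {nonneg R}) (pt : 'I_n.+1 -> T) (f : T -> R)
    (mf : measurable_fun setT f) :
  (weighted_diracs rho pt).-integrable setT (EFin \o f).
Proof.
have mfE : measurable_fun setT (EFin \o f) by exact/measurable_EFinP.
apply/integrableP; split=> //.
rewrite ge0_integral_weighted_diracs//; last exact: measurableT_comp.
by under eq_bigr => k _ do rewrite /= -EFinM; rewrite sumEFin ltry.
Qed.

Lemma integral_weighted_diracs (d : measure_display)
    (T : measurableType d) (R : realType)
    (n : nat) (rho : 'I_n.+1 -> {nonneg R}) (pt : 'I_n.+1 -> T) (f : T -> R)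
    (mf : measurable_fun setT f) :
  (\int[weighted_diracs rho pt]_x (f x)%:E
    = (\sum_(k < n.+1) (rho k)%:num * f (pt k))%:E)%E.
Proof.
have mfE : measurable_fun setT (EFin \o f) by exact/measurable_EFinP.
rewrite integralE !ge0_integral_weighted_diracs//.
- under eq_bigr => k _ do rewrite funeposE /= -EFin_max -EFinM.
  under [X in (_ - X)%E]eq_bigr => k _ do rewrite funenegE /= -EFin_max -EFinM.
  rewrite !sumEFin -EFinB -sumrB; congr (_%:E); apply: eq_bigr => k _.
  rewrite -mulrBr; congr (_ * _).
  by case: (leP (f (pt k)) 0) => h; case: (leP (- f (pt k)) 0) => h'; lra.
- exact: measurable_funeneg.
- exact: measurable_funepos.
Qed.

(** * Joint diagonalization of two commuting real symmetric matrices *)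

Section spectral.
Local Open Scope sesquilinear_scope.
Local Open Scope complex_scope.

(** Half the sum and half the difference of the hypotheses. Applied to A + iB and its adjoint, this
    separates the eigenvector relation of A from that of B even though the coordinate [w] is
    complex. *)
Lemma complex_split (R : rcfType) (u v z w : R[i]) :
  u + 'i%C * v = z * w -> u - 'i%C * v = z^* * w ->
  u = (complex.Re z)%:C * w /\ v = (complex.Im z)%:C * w.
Proof.
case: u v z w => [u1 u2] [v1 v2] [z1 z2] [w1 w2] /eqP + /eqP.
rewrite !eq_complex /= => /andP[/eqP h1 /eqP h2] /andP[/eqP h3 /eqP h4].
by split; apply/eqP; rewrite eq_complex /=; apply/andP; split; apply/eqP; lra.
Qed.

(* A + iB is normal over R[i]. *)
Lemma commuting_symmetric_spectral (R : realType) (n : nat) (A B : 'M[R]_n)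
    (symA : A^T = A) (symB : B^T = B) (AB : A *m B = B *m A) :
  exists (x y : 'I_n -> R) (P : 'I_n -> 'I_n -> R[i]),
    [/\ forall k l, \sum_m P k m * (P l m)^* = (k == l)%:R,
        forall m j, \sum_k (P k m)^* * P k j = (m == j)%:R,
        forall k j, \sum_m P k m * (A m j)%:C = (x k)%:C * P k j &
        forall k j, \sum_m P k m * (B m j)%:C = (y k)%:C * P k j].
Proof.
pose i : R[i] := 'i%C.
pose Ac := map_mx (real_complex R) A; pose Bc := map_mx (real_complex R) B.
have ABc : Ac *m Bc = Bc *m Ac by rewrite -!map_mxM AB.
pose N := Ac + i *: Bc.
have NE : N^t* = Ac - i *: Bc.
  apply/matrixP => k j; rewrite !mxE.
  rewrite -[in RHS]symA -[in RHS]symB !mxE rmorphD rmorphM /=.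
  by apply/eqP; rewrite eq_complex /=; apply/andP; split; apply/eqP; ring.
have Nn : N \is normalmx.
  have ZA : Ac *m (i *: Bc) = (i *: Bc) *m Ac.
    by rewrite -scalemxAl -scalemxAr ABc.
  apply/normalmxP; rewrite NE /N !mulmxDl !mulmxDr !mulmxN !mulNmx ZA.
  by rewrite addrACA.
have /orthomx_spectralP NP := Nn; set P := spectralmx N in NP.
set D := spectral_diag N in NP.
have Pu : P \is unitarymx by exact: spectral_unitarymx.
have PPs : P *m P^t* = 1%:M by exact/unitarymxP.
rewrite invmx_unitary// in NP.
have PN : P *m N = diag_mx D *m P by rewrite [in LHS]NP !mulmxA PPs mul1mx.
(* The same unitary [P] diagonalizes the adjoint, with conjugate eigenvalues. *)
have PNs : P *m N^t* = diag_mx (map_mx Num.conj D) *m P.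
  rewrite [in LHS]NP !trmx_mul !map_mxM !map_trmx trmxK -map_mx_comp.
  rewrite (map_mx_id (@conjCK _)) !mulmxA [P *m _]PPs mul1mx.
  by rewrite tr_diag_mx map_diag_mx.
have e1 k j : (P *m Ac) k j + i * (P *m Bc) k j = D 0 k * P k j.
  have /matrixP/(_ k j) := PN; rewrite mulmxDr -scalemxAr mul_diag_mx.
  by move: (P *m Ac) (P *m Bc) => PA PB; rewrite !mxE.
have e2 k j : (P *m Ac) k j - i * (P *m Bc) k j = (D 0 k)^* * P k j.
  have /matrixP/(_ k j) := PNs; rewrite NE mulmxDr mulmxN -scalemxAr mul_diag_mx.
  by move: (P *m Ac) (P *m Bc) => PA PB; rewrite !mxE.
exists (fun k => complex.Re (D 0 k)), (fun k => complex.Im (D 0 k)), P.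
split=> [k l|m j|k j|k j].
- have /matrixP/(_ k l) := PPs; rewrite !mxE => <-.
  by apply: eq_bigr => m _; rewrite !mxE.
- have /matrixP/(_ m j) := mulmx1C PPs; rewrite !mxE => <-.
  by apply: eq_bigr => k _; rewrite !mxE.
- have [<- _] := complex_split (e1 k j) (e2 k j); rewrite mxE.
  by apply: eq_bigr => m _; rewrite mxE.
- have [_ <-] := complex_split (e1 k j) (e2 k j); rewrite mxE.
  by apply: eq_bigr => m _; rewrite mxE.
Qed.

End spectral.

(** * Commuting 4x4 extensions and the atoms of a normalized functional *)

(* The unknown entries p, q, r, al, ga of the bordered matrices A and B in
   normalized_four_atoms; the equations say that A and B commute, the first one
   being the commutator in position (1, 2). *)
Lemma commuting_extension_parameters (R : realType) (a b c d : R)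
    (nc : 1 + a * c + b * d != b ^+ 2 + c ^+ 2) :
  exists p q r al ga : R,
    [/\ (p != 0) || (q != 0),
        p * r - q ^+ 2 = b ^+ 2 + c ^+ 2 - 1 - a * c - b * d,
        q * a + r * b + p * ga = p * b + q * c + al * q &
        q * b + r * c + q * ga = p * c + q * d + al * r].
Proof.
set D := b ^+ 2 + c ^+ 2 - 1 - a * c - b * d.
have D0 : D != 0.
  by apply: contraNneq nc => D0; apply/eqP; rewrite /D in D0; lra.
(* Solve [p * r - q ^+ 2 = D] by the sign of [D]: a negative value is supplied by [q] alone, a
   positive one by [p = r]. The last two equations then determine [al] and [ga] after cancelling the
   square root, and [D0] makes [p] or [q] nonzero. *)
have [Dn|Dp] := leP D 0.
  have S : Num.sqrt (- D) ^+ 2 = - D by rewrite sqr_sqrtr// oppr_ge0.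
  exists 0, (Num.sqrt (- D)), 0, (a - c), (d - b); split; try ring.
    by rewrite sqrtr_eq0 -ltNge oppr_gt0 lt_neqAle D0 Dn orbT.
  by rewrite S; ring.
have S : Num.sqrt D ^+ 2 = D by rewrite sqr_sqrtr// ltW.
exists (Num.sqrt D), 0, (Num.sqrt D), 0, 0; split; try ring.
  by rewrite sqrtr_eq0 -ltNge Dp.
by rewrite -expr2 S; ring.
Qed.

Definition mx4_of_rows (R : realType) (rows : seq (seq R)) : 'M[R]_4 :=
  \matrix_(i < 4, j < 4) ((nth [::] rows i)`_j).

Section normalized.
Local Open Scope complex_scope.

Lemma normalized_four_atoms (R : realType) (a b c d : R)
    (nc : 1 + a * c + b * d != b ^+ 2 + c ^+ 2) :
  exists rho x y : 'I_4 -> R,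
    [/\ forall k, 0 < rho k,
        forall k l, x k = x l -> y k = y l -> k = l &
        [/\ [/\ \sum_k rho k = 1,
            \sum_k rho k * x k = 0 & \sum_k rho k * y k = 0],
            [/\ \sum_k rho k * (x k ^+ 2) = 1,
            \sum_k rho k * (x k * y k) = 0 & \sum_k rho k * (y k ^+ 2) = 1] &
            [/\ \sum_k rho k * (x k ^+ 3) = a,
            \sum_k rho k * (x k ^+ 2 * y k) = b,
            \sum_k rho k * (x k * y k ^+ 2) = c &
            \sum_k rho k * (y k ^+ 3) = d]]].
Proof.
have [p [q [r [al [ga [pq0 e1 e2 e3]]]]]] := commuting_extension_parameters nc.
(* Multiplication by x and by y in an orthonormal basis formed by 1, x, y and one extra vector. Row
   y of [A] equals row x of [B], since both represent the product xy. *)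
pose A := mx4_of_rows [:: [:: 0; 1; 0; 0]; [:: 1; a; b; p];
                          [:: 0; b; c; q]; [:: 0; p; q; al]].
pose B := mx4_of_rows [:: [:: 0; 0; 1; 0]; [:: 0; b; c; q];
                          [:: 1; c; d; r]; [:: 0; q; r; ga]].
have symA : A^T = A.
  by apply/matrixP => -[[|[|[|[|//]]]] ?] [[|[|[|[|//]]]] ?]; rewrite !mxE.
have symB : B^T = B.
  by apply/matrixP => -[[|[|[|[|//]]]] ?] [[|[|[|[|//]]]] ?]; rewrite !mxE.
have AB : A *m B = B *m A.
  apply/matrixP => i j; rewrite !mxE !big_ord_recl !big_ord0 !mxE /=.
  by case: i j => -[|[|[|[|//]]]] ? [[|[|[|[|//]]]] ?] /=; lra.
have [x [y [P [PPr PPc PA PB]]]] := commuting_symmetric_spectral symA symB AB.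
pose o1 : 'I_4 := lift ord0 ord0.
pose o2 : 'I_4 := lift ord0 (lift ord0 ord0).
pose o3 : 'I_4 := lift ord0 (lift ord0 (lift ord0 ord0)).
(* Row k of P is u k times (1, x k, y k, g (x k) (y k)). *)
pose u k := P k ord0.
have P1 k : P k o1 = (x k)%:C * u k.
  by rewrite -PA !big_ord_recl big_ord0 !mxE /= !rmorph0 !rmorph1; ring.
have P2 k : P k o2 = (y k)%:C * u k.
  by rewrite -PB !big_ord_recl big_ord0 !mxE /= !rmorph0 !rmorph1; ring.
have P3p k : p%:C * P k o3 = (x k ^+ 2 - 1 - a * x k - b * y k)%:C * u k.
  have := PA k o1; rewrite !big_ord_recl big_ord0 !mxE /=.
  rewrite -/o1 -/o2 -/o3 -/(u k) P1 P2.
  move: (u k) (P k o3) => [u1 u2] [w1 w2] /eqP.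
  rewrite eq_complex /= => /andP[/eqP h1 /eqP h2].
  by apply/eqP; rewrite eq_complex /=; apply/andP; split; apply/eqP; lra.
have P3q k : q%:C * P k o3 = (x k * y k - b * x k - c * y k)%:C * u k.
  have := PA k o2; rewrite !big_ord_recl big_ord0 !mxE /=.
  rewrite -/o1 -/o2 -/o3 -/(u k) P1 P2.
  move: (u k) (P k o3) => [u1 u2] [w1 w2] /eqP.
  rewrite eq_complex /= => /andP[/eqP h1 /eqP h2].
  by apply/eqP; rewrite eq_complex /=; apply/andP; split; apply/eqP; lra.
(* This is the cyclicity of 1: as [p] or [q] is nonzero, the extra coordinate is also a function of
   the atom times [u k]. A single [g] for all [k] ensures that equal atoms give proportional
   rows. *)
have [g P3] : exists g : R -> R -> R,
    forall k, P k o3 = (g (x k) (y k))%:C * u k.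
  case/orP: pq0 => s0.
    exists (fun x y => p^-1 * (x ^+ 2 - 1 - a * x - b * y)) => k.
    by rewrite rmorphM -mulrA -P3p mulrA -rmorphM mulVf// rmorph1 mul1r.
  exists (fun x y => q^-1 * (x * y - b * x - c * y)) => k.
  by rewrite rmorphM -mulrA -P3q mulrA -rmorphM mulVf// rmorph1 mul1r.
pose v (k j : 'I_4) := [:: 1; x k; y k; g (x k) (y k)]`_j.
have Pv k j : P k j = (v k j)%:C * u k.
  rewrite /v; case: j => -[|[|[|[|//]]]] lt /=.
  - by rewrite mul1r; congr (P _ _); apply/val_inj.
  - by rewrite -P1; congr (P _ _); apply/val_inj.
  - by rewrite -P2; congr (P _ _); apply/val_inj.
  - by rewrite -P3; congr (P _ _); apply/val_inj.
have u0 k : u k != 0.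
  apply: contra_eq_neq (PPr k k) => uk0.
  rewrite eqxx big1 1?eq_sym ?oner_eq0// => m _; by rewrite Pv uk0 mulr0 mul0r.
(* The squared modulus of [u k], written so as to be an element of [R]. *)
pose rho k := complex.Re (u k) ^+ 2 + complex.Im (u k) ^+ 2.
have rhoE k (s t : R) : (s%:C * u k)^* * (t%:C * u k) = (rho k * (s * t))%:C.
  rewrite /rho; case: (u k) => u1 u2; apply/eqP; rewrite eq_complex /=.
  by apply/andP; split; apply/eqP; ring.
have moment1 m n : \sum_k rho k * (v k m * v k n) = (m == n)%:R.
  apply: (@complexI R); rewrite rmorph_sum rmorph_nat -PPc.
  by apply: eq_bigr => k _; rewrite !Pv; exact/esym/rhoE.
(* Entrywise form of the spectral decomposition: [C] is the adjoint of [P] times the diagonal matrix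
   of [z] times [P]. *)
have moment_compression (C : 'M[R]_4) (z : 'I_4 -> R) :
    (forall k j, \sum_m P k m * (C m j)%:C = (z k)%:C * P k j) ->
    forall m n, \sum_k rho k * (v k m * (z k * v k n)) = C m n.
  move=> PC m n; apply: (@complexI R); rewrite rmorph_sum.
  transitivity (\sum_k (P k m)^* * \sum_l P k l * (C l n)%:C).
    apply: eq_bigr => k _; rewrite PC !Pv; apply: etrans (esym (rhoE _ _ _)) _.
    by congr (_ * _); rewrite [RHS]mulrA; congr (_ * _); exact: rmorphM.
  under eq_bigr do rewrite mulr_sumr; rewrite exchange_big /=.
  under eq_bigr => l _.
    under eq_bigr do rewrite mulrA.
    rewrite -mulr_suml PPc; over.
  rewrite (bigD1 m)//= eqxx mul1r big1 ?addr0// => l lm.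
  by rewrite eq_sym (negPf lm) mul0r.
have momentA := moment_compression _ _ PA.
have momentB := moment_compression _ _ PB.
exists rho, x, y; split.
- move=> k; rewrite lt_neqAle addr_ge0 ?sqr_ge0// andbT eq_sym.
  apply: contraNneq (u0 k); rewrite /rho; case: (u k) => u1 u2 /=.
  by move/eqP; rewrite paddr_eq0 ?sqr_ge0// !sqrf_eq0 => /andP[/eqP-> /eqP->].
- move=> k l xkl ykl; apply/eqP/negPn/negP => kl.
  (* Rows at equal atoms are proportional; pairing with row [k] and using orthonormality forces
     [u l = 0]. *)
  have : u l * (\sum_m P k m * (P k m)^* ) = u k * (\sum_m P l m * (P k m)^* ).
    rewrite !mulr_sumr; apply: eq_bigr => m _; rewrite !mulrA; congr (_ * _).
    by rewrite !Pv /v xkl ykl mulrCA [RHS]mulrCA [u l * _]mulrC.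
  by rewrite !PPr eqxx eq_sym (negPf kl) mulr1 mulr0; apply/eqP.
(* A monomial of degree one to three is x or y times a product of two of 1, x, y, so its moment is
   an entry of the upper left 3x3 block of [A] or [B]. *)
have M1 : _ = 1 := moment1 ord0 ord0.
have MA0 := momentA ord0 ord0; have MA1 := momentA ord0 o1.
have MA2 := momentA ord0 o2; have MA11 := momentA o1 o1.
have MA12 := momentA o1 o2; have MA22 := momentA o2 o2.
have MB0 := momentB ord0 ord0; have MB2 := momentB ord0 o2.
have MB22 := momentB o2 o2.
split; split; [move: M1|move: MA0|move: MB0|move: MA1|move: MA2|move: MB2
  |move: MA11|move: MA12|move: MA22|move: MB22];
  rewrite ?mxE /= => M; apply: etrans M;
  by apply: eq_bigr => k _; rewrite /v /=; ring.
Qed.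

End normalized.

(** * Affine normalization of the moments *)

(** Cholesky factorization of M(1) divided by beta_00, with lower triangular factor of rows (1, 0,
    0), (m1, s, 0), (m2, t, w). Here m1, m2 are the means, and s, t, w factor the covariance
    matrix. *)
Lemma moment_mx1_cholesky (R : realType) (beta : nat -> nat -> R)
    (beta00_gt0 : 0 < beta 0%N 0%N) (M1_posdef : posdefmx (moment_mx1 beta)) :
  exists m1 s m2 t w : R,
    [/\ 0 < s, 0 < w,
        beta 1%N 0%N = beta 0%N 0%N * m1 /\ beta 0%N 1%N = beta 0%N 0%N * m2 &
        [/\ beta 2%N 0%N = beta 0%N 0%N * (m1 ^+ 2 + s ^+ 2),
            beta 1%N 1%N = beta 0%N 0%N * (m1 * m2 + s * t) &
            beta 0%N 2%N = beta 0%N 0%N * (m2 ^+ 2 + t ^+ 2 + w ^+ 2)]].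
Proof.
set l := beta 0%N 0%N in beta00_gt0 *; have l0 : l != 0 by rewrite gt_eqF.
(* The quadratic form of M(1), that is, the functional applied to the square of v0 + v1 x + v2 y. *)
pose q (v0 v1 v2 : R) :=
  l * v0 ^+ 2 + beta 2%N 0%N * v1 ^+ 2 + beta 0%N 2%N * v2 ^+ 2
  + 2 * (beta 1%N 0%N * v0 * v1 + beta 0%N 1%N * v0 * v2 + beta 1%N 1%N * v1 * v2).
have qgt0 v0 v1 v2 : (v1 != 0) || (v2 != 0) -> 0 < q v0 v1 v2.
  move=> v12; pose v : 'cV[R]_3 := \col_i [:: v0; v1; v2]`_i.
  have vn0 : v != 0.
    apply: contraTneq v12 => /colP v0E; rewrite negb_or !negbK.
    have := v0E 1; have := v0E (inord 2); rewrite !mxE/= inordK// => /= -> ->.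
    by rewrite eqxx.
  have := M1_posdef.2 v vn0; congr (_ < _).
  by rewrite !(mxE, big_ord_recl, big_ord0) /q /l /=; ring.
pose m1 := beta 1%N 0%N / l; pose m2 := beta 0%N 1%N / l.
have b10 : beta 1%N 0%N = l * m1 by rewrite /m1; field.
have b01 : beta 0%N 1%N = l * m2 by rewrite /m2; field.
pose s2 := beta 2%N 0%N / l - m1 ^+ 2.
have s2gt0 : 0 < s2.
  have := qgt0 (- m1) 1 0; rewrite oner_neq0 => /(_ isT).
  suff -> : q (- m1) 1 0 = l * s2 by rewrite pmulr_rgt0.
  by rewrite /q b10 /s2; field.
pose s := Num.sqrt s2; have sE : s ^+ 2 = s2 by rewrite sqr_sqrtr// ltW.
have s0 : 0 < s by rewrite sqrtr_gt0.
have sn0 : s != 0 by rewrite gt_eqF.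
pose t := (beta 1%N 1%N / l - m1 * m2) / s.
have b20 : beta 2%N 0%N = l * (m1 ^+ 2 + s ^+ 2) by rewrite sE /s2; field.
have b11 : beta 1%N 1%N = l * (m1 * m2 + s * t).
  by rewrite /t; field; rewrite l0 sn0.
pose w2 := beta 0%N 2%N / l - m2 ^+ 2 - t ^+ 2.
have w2gt0 : 0 < w2.
  (* The coefficients of y - m2 - (t/s)(x - m1), the residual of the regression of y on x. *)
  have := qgt0 (t / s * m1 - m2) (- (t / s)) 1; rewrite oner_neq0 orbT => /(_ isT).
  suff -> : q (t / s * m1 - m2) (- (t / s)) 1 = l * w2 by rewrite pmulr_rgt0.
  by rewrite /q b10 b01 b20 b11 /w2; field; rewrite l0 sn0.
pose w := Num.sqrt w2; have wE : w ^+ 2 = w2 by rewrite sqr_sqrtr// ltW.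
exists m1, s, m2, t, w; split=> //; first by rewrite sqrtr_gt0.
by split=> //; rewrite wE /w2; field.
Qed.

(* The four third-moment equations express beta through the moments a, b, c, d
   of the normalized variables X, Y, where x = m1 + s X, y = m2 + t X + w Y. *)
Lemma compat_normalized (R : realType) (beta : nat -> nat -> R) (W : 'M[R]_3)
    (l m1 s m2 t w a b c d : R) (l0 : l != 0) (s0 : s != 0) (w0 : w != 0)
    (MW_B : moment_mx1 beta *m W = moment_B2 beta)
    (b00 : beta 0%N 0%N = l) (b10 : beta 1%N 0%N = l * m1)
    (b01 : beta 0%N 1%N = l * m2) (b20 : beta 2%N 0%N = l * (m1 ^+ 2 + s ^+ 2))
    (b11 : beta 1%N 1%N = l * (m1 * m2 + s * t))
    (b02 : beta 0%N 2%N = l * (m2 ^+ 2 + t ^+ 2 + w ^+ 2))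
    (b30 : beta 3%N 0%N = l * (m1 ^+ 3 + 3 * m1 * s ^+ 2 + s ^+ 3 * a))
    (b21 : beta 2%N 1%N
      = l * (m1 ^+ 2 * m2 + 2 * m1 * s * t + s ^+ 2 * m2
             + s ^+ 2 * t * a + s ^+ 2 * w * b))
    (b12 : beta 1%N 2%N
      = l * (m1 * (m2 ^+ 2 + t ^+ 2 + w ^+ 2)
             + s * (2 * m2 * t + t ^+ 2 * a + 2 * t * w * b + w ^+ 2 * c)))
    (b03 : beta 0%N 3%N
      = l * (m2 ^+ 3 + 3 * m2 * (t ^+ 2 + w ^+ 2) + t ^+ 3 * a
             + 3 * t ^+ 2 * w * b + 3 * t * w ^+ 2 * c + w ^+ 3 * d)) :
  (W^T *m moment_mx1 beta *m W) ord0 ord_max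
    - (W^T *m moment_mx1 beta *m W) 1 1
  = l * s ^+ 2 * w ^+ 2 * (1 + a * c + b * d - b ^+ 2 - c ^+ 2).
Proof.
pose i2 : 'I_3 := lift ord0 (lift ord0 ord0).
pose i1 : 'I_3 := lift ord0 ord0.
have MW i j : \sum_k moment_mx1 beta i k * W k j = moment_B2 beta i j.
  by rewrite -MW_B mxE.
(* K = L^T W where M(1) = l L L^T, so that W^T M(1) W = l K^T K. *)
pose K0 j := W ord0 j + m1 * W i1 j + m2 * W i2 j.
pose K1 j := s * W i1 j + t * W i2 j.
pose K2 j := w * W i2 j.
have E0 j : l * K0 j = moment_B2 beta ord0 j.
  rewrite -MW !big_ord_recl big_ord0 !mxE /= b00 b10 b01 -/i1 -/i2 /K0; ring.
have E1 j : l * (m1 * K0 j + s * K1 j) = moment_B2 beta i1 j.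
  rewrite -MW !big_ord_recl big_ord0 !mxE /= b10 b20 b11 -/i1 -/i2 /K0 /K1; ring.
have E2 j : l * (m2 * K0 j + t * K1 j + w * K2 j) = moment_B2 beta i2 j.
  rewrite -MW !big_ord_recl big_ord0 !mxE /= b01 b11 b02 -/i1 -/i2 /K0 /K1 /K2; ring.
have gram i j : (W^T *m moment_mx1 beta *m W) i j
    = l * (K0 i * K0 j + K1 i * K1 j + K2 i * K2 j).
  rewrite -mulmxA mxE; under eq_bigr => k _ do rewrite MW_B mxE.
  rewrite !big_ord_recl big_ord0 -/i1 -/i2 -E0 -E1 -E2 /K0 /K1 /K2; ring.
(* Forward substitution: a column of K is determined by the triangular system with diagonal 1, s,
   w. *)
have solve j k0 k1 k2 : moment_B2 beta ord0 j = l * k0 ->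
    moment_B2 beta i1 j = l * (m1 * k0 + s * k1) ->
    moment_B2 beta i2 j = l * (m2 * k0 + t * k1 + w * k2) ->
    [/\ K0 j = k0, K1 j = k1 & K2 j = k2].
  rewrite -E0 -E1 -E2 => /(mulfI l0) -> /(mulfI l0)/addrI/(mulfI s0) ->.
  by move=> /(mulfI l0)/addrI/(mulfI w0) ->.
(* The columns of K hold the normalized moments of x^2, xy and y^2 against 1, X, Y. *)
have [p0 p1 p2] := solve ord0 (m1 ^+ 2 + s ^+ 2) (2 * m1 * s + s ^+ 2 * a)
  (s ^+ 2 * b) ltac:(by rewrite mxE /= b20) ltac:(by rewrite mxE /= b30; ring)
  ltac:(by rewrite mxE /= b21; ring).
have [q0 q1 q2] := solve 1 (m1 * m2 + s * t)
  (m1 * t + m2 * s + s * t * a + s * w * b) (m1 * w + s * t * b + s * w * c)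
  ltac:(by rewrite mxE /= b11) ltac:(by rewrite mxE /= b21; ring)
  ltac:(by rewrite mxE /= b12; ring).
have [r0 r1 r2] := solve ord_max (m2 ^+ 2 + t ^+ 2 + w ^+ 2)
  (2 * m2 * t + t ^+ 2 * a + 2 * t * w * b + w ^+ 2 * c)
  (2 * m2 * w + t ^+ 2 * b + 2 * t * w * c + w ^+ 2 * d)
  ltac:(by rewrite mxE /= b02) ltac:(by rewrite mxE /= b12; ring)
  ltac:(by rewrite mxE /= b03; ring).
by rewrite !gram p0 p1 p2 q0 q1 q2 r0 r1 r2; ring.
Qed.

(** One expansion serves all moments of degree at most three after an affine change of variables:
    lower degrees are padded with the constant factor 1, whose coefficients are 1, 0, 0. *)
Lemma normalized_cubic_moment (R : realType) (a b c d : R)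
    (rho x y : 'I_4 -> R)
    (E0 : \sum_k rho k = 1) (Ex : \sum_k rho k * x k = 0)
    (Ey : \sum_k rho k * y k = 0) (Exx : \sum_k rho k * (x k ^+ 2) = 1)
    (Exy : \sum_k rho k * (x k * y k) = 0)
    (Eyy : \sum_k rho k * (y k ^+ 2) = 1)
    (Exxx : \sum_k rho k * (x k ^+ 3) = a)
    (Exxy : \sum_k rho k * (x k ^+ 2 * y k) = b)
    (Exyy : \sum_k rho k * (x k * y k ^+ 2) = c)
    (Eyyy : \sum_k rho k * (y k ^+ 3) = d)
    (l p1 q1 r1 p2 q2 r2 p3 q3 r3 : R) :
  \sum_k l * rho k * ((p1 + q1 * x k + r1 * y k) * (p2 + q2 * x k + r2 * y k)
                  * (p3 + q3 * x k + r3 * y k))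
  = l * (p1 * p2 * p3
    + (p1 * (q2 * q3 + r2 * r3) + p2 * (q1 * q3 + r1 * r3)
       + p3 * (q1 * q2 + r1 * r2))
    + q1 * q2 * q3 * a + (q1 * q2 * r3 + q1 * r2 * q3 + r1 * q2 * q3) * b
    + (q1 * r2 * r3 + r1 * q2 * r3 + r1 * r2 * q3) * c + r1 * r2 * r3 * d).
Proof.
transitivity (l * p1 * p2 * p3 * (\sum_k rho k)
  + l * (p1 * p2 * q3 + p1 * q2 * p3 + q1 * p2 * p3) * (\sum_k rho k * x k)
  + l * (p1 * p2 * r3 + p1 * r2 * p3 + r1 * p2 * p3) * (\sum_k rho k * y k)
  + l * (p1 * q2 * q3 + p2 * q1 * q3 + p3 * q1 * q2) * (\sum_k rho k * x k ^+ 2)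
  + l * (p1 * (q2 * r3 + r2 * q3) + p2 * (q1 * r3 + r1 * q3)
         + p3 * (q1 * r2 + r1 * q2)) * (\sum_k rho k * (x k * y k))
  + l * (p1 * r2 * r3 + p2 * r1 * r3 + p3 * r1 * r2) * (\sum_k rho k * y k ^+ 2)
  + l * q1 * q2 * q3 * (\sum_k rho k * x k ^+ 3)
  + l * (q1 * q2 * r3 + q1 * r2 * q3 + r1 * q2 * q3)
    * (\sum_k rho k * (x k ^+ 2 * y k))
  + l * (q1 * r2 * r3 + r1 * q2 * r3 + r1 * r2 * q3)
    * (\sum_k rho k * (x k * y k ^+ 2))
  + l * r1 * r2 * r3 * (\sum_k rho k * y k ^+ 3)); last first.
  by rewrite E0 Ex Ey Exx Exy Eyy Exxx Exxy Exyy Eyyy; ring.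
rewrite !mulr_sumr -!big_split /=; apply: eq_bigr => k _; ring.
Qed.

(** * Construction of the representing measure *)

Lemma atomic_representing_measure (R : realType) (n : nat)
    (beta : nat -> nat -> R) (rho x y : 'I_n.+1 -> R)
    (rho_gt0 : forall k, 0 < rho k)
    (xy_inj : forall k l, x k = x l -> y k = y l -> k = l)
    (moments : forall i j, (i + j <= 3)%N ->
      \sum_k rho k * (x k ^+ i * y k ^+ j) = beta i j) :
  exists mu : {measure set (measurableTypeR R * measurableTypeR R)%type
                       -> \bar R},
    atomic n.+1 mu /\ representing_measure beta mu.
Proof.
pose pt k : measurableTypeR R * measurableTypeR R := (x k, y k).
pose wt k := NngNum (ltW (rho_gt0 k)).
exists (weighted_diracs wt pt); split.
  exists rho, pt; split=> // [k l [] | A mA]; first exact: xy_inj.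
  exact: weighted_diracsE.
move=> i j /moments <-.
pose f (p : measurableTypeR R * measurableTypeR R) : R := p.1 ^+ i * p.2 ^+ j.
have mf : measurable_fun setT f.
  by apply: measurable_funM; apply: measurable_funX;
    [exact: measurable_fst | exact: measurable_snd].
split; first exact: (@integrable_weighted_diracs _ _ _ _ wt pt _ mf).
exact: (@integral_weighted_diracs _ _ _ _ wt pt _ mf).
Qed.

Theorem theorem3p8 (R : realType) (beta : nat -> nat -> R)
    (beta00_gt0 : 0 < beta 0%N 0%N)
    (M1_posdef : posdefmx (moment_mx1 beta))
    (ran_B2 : mx_range (moment_B2 beta) `<=` mx_range (moment_mx1 beta))
    (W : 'M[R]_3) (MW_B : moment_mx1 beta *m W = moment_B2 beta)
    (b y : R)
    (b_def : b = (W^T *m moment_mx1 beta *m W) ord0 ord_max)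
    (y_def : y = (W^T *m moment_mx1 beta *m W) 1 1)
    (b_neq_y : b <> y) :
  exists mu : {measure set (measurableTypeR R * measurableTypeR R)%type
                       -> \bar R},
    atomic 4 mu /\ representing_measure beta mu.
Proof.
have [m1 [s [m2 [t [w [s_gt0 w_gt0 [b10 b01] [b20 b11 b02]]]]]]] :=
  moment_mx1_cholesky beta00_gt0 M1_posdef.
set l := beta 0%N 0%N in beta00_gt0 b10 b01 b20 b11 b02.
have l0 : l != 0 by rewrite gt_eqF.
have s0 : s != 0 by rewrite gt_eqF.
have w0 : w != 0 by rewrite gt_eqF.
(* The normalized third moments, solved one after another from the triangular system [b30], [b21],
   [b12], [b03]. *)
pose a30 := (beta 3%N 0%N / l - m1 ^+ 3 - 3 * m1 * s ^+ 2) / s ^+ 3.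
pose a21 := (beta 2%N 1%N / l - m1 ^+ 2 * m2 - 2 * m1 * s * t - s ^+ 2 * m2
             - s ^+ 2 * t * a30) / (s ^+ 2 * w).
pose a12 := ((beta 1%N 2%N / l - m1 * (m2 ^+ 2 + t ^+ 2 + w ^+ 2)) / s
             - 2 * m2 * t - t ^+ 2 * a30 - 2 * t * w * a21) / w ^+ 2.
pose a03 := (beta 0%N 3%N / l - m2 ^+ 3 - 3 * m2 * (t ^+ 2 + w ^+ 2)
             - t ^+ 3 * a30 - 3 * t ^+ 2 * w * a21 - 3 * t * w ^+ 2 * a12)
            / w ^+ 3.
have b30 : beta 3%N 0%N = l * (m1 ^+ 3 + 3 * m1 * s ^+ 2 + s ^+ 3 * a30).
  by rewrite /a30; field; rewrite l0 s0.
have b21 : beta 2%N 1%N = l * (m1 ^+ 2 * m2 + 2 * m1 * s * t + s ^+ 2 * m2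
    + s ^+ 2 * t * a30 + s ^+ 2 * w * a21).
  by rewrite /a21; move: (a30) => u; field; rewrite l0 s0 w0.
have b12 : beta 1%N 2%N = l * (m1 * (m2 ^+ 2 + t ^+ 2 + w ^+ 2)
    + s * (2 * m2 * t + t ^+ 2 * a30 + 2 * t * w * a21 + w ^+ 2 * a12)).
  by rewrite /a12; move: (a30) (a21) => u v; field; rewrite l0 s0 w0.
have b03 : beta 0%N 3%N = l * (m2 ^+ 3 + 3 * m2 * (t ^+ 2 + w ^+ 2)
    + t ^+ 3 * a30 + 3 * t ^+ 2 * w * a21 + 3 * t * w ^+ 2 * a12
    + w ^+ 3 * a03).
  by rewrite /a03; move: (a30) (a21) (a12) => u v z; field; rewrite l0 w0.
(* [b - y] is a multiple of the difference of the two sides, so equality here would give [b = y]. *)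
have nc : 1 + a30 * a12 + a21 * a03 != a21 ^+ 2 + a12 ^+ 2.
  apply: contra_not_neq b_neq_y => nc; apply/eqP; rewrite -subr_eq0 b_def y_def.
  rewrite (compat_normalized l0 s0 w0 MW_B erefl b10 b01 b20 b11 b02
    b30 b21 b12 b03).
  by rewrite nc; apply/eqP; ring.
have [rho [x [z [rho_gt0 inj_xz
  [[E0 Ex Ez] [Exx Exz Ezz] [Exxx Exxz Exzz Ezzz]]]]]] :=
  normalized_four_atoms nc.
have E := normalized_cubic_moment E0 Ex Ez Exx Exz Ezz Exxx Exxz Exzz Ezzz l.
(* The normalized atoms are mapped back by the affine change of variables, injective since [s] and
   [w] are nonzero, and the weights are scaled to total mass [l]. *)
apply: (@atomic_representing_measure _ 3 _ (fun k => l * rho k)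
  (fun k => m1 + s * x k) (fun k => m2 + t * x k + w * z k)).
- by move=> k; rewrite mulr_gt0.
- move=> k k' /addrI/(mulfI s0) xx; rewrite xx => /addrI/(mulfI w0).
  exact: inj_xz.
move=> [|[|[|[|//]]]] [|[|[|[|//]]]] // _.
- rewrite -/l; apply: etrans (etrans (E 1 0 0 1 0 0 1 0 0) _); last by ring.
  by apply: eq_bigr => k _; ring.
- rewrite b01; apply: etrans (etrans (E m2 t w 1 0 0 1 0 0) _); last by ring.
  by apply: eq_bigr => k _; ring.
- rewrite b02; apply: etrans (etrans (E m2 t w m2 t w 1 0 0) _); last by ring.
  by apply: eq_bigr => k _; ring.
- rewrite b03; apply: etrans (etrans (E m2 t w m2 t w m2 t w) _); last by ring.
  by apply: eq_bigr => k _; ring.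
- rewrite b10; apply: etrans (etrans (E m1 s 0 1 0 0 1 0 0) _); last by ring.
  by apply: eq_bigr => k _; ring.
- rewrite b11; apply: etrans (etrans (E m1 s 0 m2 t w 1 0 0) _); last by ring.
  by apply: eq_bigr => k _; ring.
- rewrite b12; apply: etrans (etrans (E m1 s 0 m2 t w m2 t w) _); last by ring.
  by apply: eq_bigr => k _; ring.
- rewrite b20; apply: etrans (etrans (E m1 s 0 m1 s 0 1 0 0) _); last by ring.
  by apply: eq_bigr => k _; ring.
- rewrite b21; apply: etrans (etrans (E m1 s 0 m1 s 0 m2 t w) _); last by ring.
  by apply: eq_bigr => k _; ring.
- rewrite b30; apply: etrans (etrans (E m1 s 0 m1 s 0 m1 s 0) _); last by ring.
  by apply: eq_bigr => k _; ring.
Qed.
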